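(* Let $T$ be an in-star with centre $c$ and leaves $\ell_1,\dots,\ell_n$ (arcs $\ell_i\to c$), carrying only green pebbles: $g_0\ge 0$ on $c$ and $g_i\ge0$ on $\ell_i$. Then the game value of this \textsc{blocking pebbles} position is the nimber $*g_0$.
   Context: \textsc{Blocking pebbles} with green pebbles only is an impartial game on a finite directed acyclic graph with a number of (green) pebbles on each vertex. A move by either player: choose a vertex $v$ and either (1) move a positive number of pebbles from $v$ to a single in-neighbour $u$ of $v$ (arc $u\to v$) at no cost, or (2) remove two pebbles from $v$ and place one pebble on an out-neighbour $w$ of $v$ (arc $v\to w$). Normal play (last player to move wins). $*n$ denotes the nimber (Sprague–Grundy value) $n$. *)

(* Defs.v *)
From mathcomp Require Import all_boot zify.
Set Implicit Arguments.
Unset Strict Implicit.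
Unset Printing Implicit Defensive.

(* Conway games [{ l | r }], with options indexed by arbitrary types. *)
Inductive game : Type :=
  Game (L R : Type) of (L -> game) & (R -> game).

(* [game_cmp x y] is the pair [(x <= y, y <= x)]; computing both at once makes
   Conway's definition of the order structurally recursive (see [game_leE]). *)
Fixpoint game_cmp (x : game) : game -> Prop * Prop :=
  fix game_cmp_x (y : game) : Prop * Prop :=
    match x, y with
    | Game xL xR xl xr, Game yL yR yl yr =>
      ((forall i : xL, ~ (game_cmp (xl i) y).2) /\
       (forall j : yR, ~ (game_cmp_x (yr j)).2),
       (forall j : yL, ~ (game_cmp_x (yl j)).1) /\
       (forall i : xR, ~ (game_cmp (xr i) y).1))
    end.

Definition game_le (x y : game) : Prop := (game_cmp x y).1.

Lemma game_cmp_swap x y :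
  ((game_cmp y x).1 <-> (game_cmp x y).2) /\
  ((game_cmp y x).2 <-> (game_cmp x y).1).
Proof.
elim: x y => xL xR xl IHl xr IHr; elim=> yL yR yl IHyl yr IHyr /=.
split; split=> -[H1 H2]; split=> i.
- by move/(IHyl i).2; apply: H1.
- by move/(IHr i (Game yl yr)).2; apply: H2.
- by move/(IHyl i).2; apply: H1.
- by move/(IHr i (Game yl yr)).2; apply: H2.
- by move/(IHl i (Game yl yr)).1; apply: H1.
- by move/(IHyr i).1; apply: H2.
- by move/(IHl i (Game yl yr)).1; apply: H1.
- by move/(IHyr i).1; apply: H2.
Qed.

Lemma game_leE L R l r L' R' l' r' :
  game_le (@Game L R l r) (@Game L' R' l' r') <->
  (forall i, ~ game_le (Game l' r') (l i)) /\
  (forall j, ~ game_le (r' j) (Game l r)).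
Proof.
split=> -[H1 H2]; split=> i; rewrite /game_le.
- by move/(game_cmp_swap (l i) (Game l' r')).1; apply: H1.
- by move/(game_cmp_swap (Game l r) (r' i)).1; apply: H2.
- by move/(game_cmp_swap (l i) (Game l' r')).1; apply: H1.
- by move/(game_cmp_swap (Game l r) (r' i)).1; apply: H2.
Qed.

Definition game_eq (x y : game) : Prop := game_le x y /\ game_le y x.

(* The impartial game played on [A] with moves [move] (from the first argument
   to the second): both players have the same options. *)
Section Impartial.
Variables (A : Type) (move : A -> A -> Prop).

Definition terminating : Prop := well_founded (fun b a => move a b).

Fixpoint game_of_acc (a : A) (acc : Acc (fun b a => move a b) a) : game :=
  let option_of (b : {b | move a b}) := game_of_acc (Acc_inv acc (proj2_sig b)) in
  Game option_of option_of.

Definition impartial_game (wf : terminating) (a : A) : game :=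
  game_of_acc (wf a).

End Impartial.

Lemma measure_terminating A (move : A -> A -> Prop) (m : A -> nat) :
  (forall a b, move a b -> m b < m a) -> terminating move.
Proof.
move=> lt_m a; have [k le_k] := ubnP (m a).
elim: k a le_k => [a lt_a0|k IHk a le_k]; first by exfalso; rewrite ltn0 in lt_a0.
by constructor=> b /lt_m lt_ba; apply: IHk; apply: leq_trans lt_ba _.
Qed.

(* [nimber n] is [*n]: the Nim heap of size [n], whose options are the [*m]
   with [m < n]. *)
Definition nim_move (n m : nat) : Prop := m < n.

Lemma nim_terminating : terminating nim_move.
Proof. exact: (measure_terminating (m := id)). Qed.

Definition nimber (n : nat) : game := impartial_game nim_terminating n.

Record dag := Dag {
  vertex :> finType;
  arc : rel vertex;
  dag_acyclic : forall s : seq vertex, cycle arc s -> s = [::]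
}.

Definition position (D : dag) := {ffun D -> nat}.

(* Take [a] pebbles from [v] and put [b] pebbles on [w]; only used with
   [v != w] (there are no loops) and [a <= p v]. *)
Definition transfer (D : dag) (p : position D) (v : D) (a : nat) (w : D)
    (b : nat) : position D :=
  [ffun x => if x == v then p x - a else if x == w then p x + b else p x].

Inductive pebble_move (D : dag) (p : position D) : position D -> Prop :=
| move_to_in_neighbour v u k of arc u v & 0 < k <= p v :
    pebble_move p (transfer p v k u k)
| move_to_out_neighbour v w of arc v w & 2 <= p v :
    pebble_move p (transfer p v 2 w 1).

Section Termination.
Variable D : dag.
Implicit Types (p : position D) (u v w : D).

Let height v := #|[set u | connect (@arc D) u v]|.
Let weight p := \sum_v p v * (height v + #|D|.+1).

Lemma arc_neq u v : arc u v -> u != v.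
Proof.
move=> uv; apply/eqP=> e; move: uv; rewrite e => vv.
by have := @dag_acyclic D [:: v]; rewrite /= vv => /(_ isT).
Qed.

Lemma arc_height u v : arc u v -> height u < height v.
Proof.
move=> uv; apply/proper_card/properP; split.
  apply/subsetP=> x; rewrite !inE => xu.
  exact: connect_trans xu (connect1 uv).
exists v; rewrite !inE ?connect0 //; apply/negP=> /connectP[s ps eu].
have := @dag_acyclic D (v :: s); rewrite /= rcons_path ps -eu uv.
by move=> /(_ isT).
Qed.

Lemma weight_transfer p v a w b : v != w -> a <= p v ->
  b * (height w + #|D|.+1) < a * (height v + #|D|.+1) ->
  weight (transfer p v a w b) < weight p.
Proof.
move=> vw le_a lt_ba; rewrite /weight (bigD1 v) //= (bigD1 w) 1?eq_sym //=.
rewrite [ltnRHS](bigD1 v) //= [X in _ < _ + X](bigD1 w) 1?eq_sym //=.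
rewrite !ffunE !eqxx eq_sym (negPf vw).
rewrite (eq_bigr (fun x => p x * (height x + #|D|.+1))); last first.
  by move=> x /andP[xv xw]; rewrite ffunE (negPf xv) (negPf xw).
set S := \sum_(i | _) _; move: S lt_ba.
move: (height v + _) (height w + _) => hv hw S lt_ba.
have : p v * hv = (p v - a) * hv + a * hv by rewrite -mulnDl subnK.
by rewrite mulnDl; lia.
Qed.

Lemma pebble_terminating : terminating (@pebble_move D).
Proof.
apply: (measure_terminating (m := weight)) => p _ [v u k uv|v w vw] /=.
  case/andP=> k0 le_k; apply: weight_transfer => //.
    by rewrite eq_sym arc_neq.
  by rewrite ltn_pmul2l // ltn_add2r arc_height.
move=> le2; apply: weight_transfer (arc_neq vw) le2 _.
have : height w <= #|D| by apply: max_card.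
by lia.
Qed.

End Termination.

Definition blocking_pebbles (D : dag) (p : position D) : game :=
  impartial_game (@pebble_terminating D) p.

Definition in_star (T : dag) (c : T) (n : nat) (leaf : 'I_n -> T) : Prop :=
  [/\ injective leaf,
      forall v, v != c <-> exists i, v = leaf i &
      forall u v, arc u v <-> exists i, u = leaf i /\ v = c].

(* Main.v *)
From mathcomp Require Import all_boot zify.
Require Import Defs.

(** The number of pebbles on the centre is the mex of its values after one move:
    a move out of the centre can lower it to any smaller value, since there is at
    least one leaf, and every other move goes from a leaf to the centre and
    raises it. *)

Definition is_mex {I : Type} (v : I -> nat) (n : nat) : Prop :=
  (forall i, v i <> n) /\ (forall k, k < n -> exists i, v i = k).

Lemma eq_mexP {I J : Type} {v : I -> nat} {w : J -> nat} {m n : nat} :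
  is_mex v m -> is_mex w n ->
  m = n <-> (forall i, n <> v i) /\ (forall j, w j <> m).
Proof.
move=> [v_neq v_lt] [w_neq w_lt]; split=> [eq_mn|[n_neq_v w_neq_m]].
  by subst n; split=> [i /esym|j]; [apply: v_neq | apply: w_neq].
case: (ltngtP m n) => // [/w_lt [j wj]|/v_lt [i vi]].
- by case: (w_neq_m j).
- by case: (n_neq_v i).
Qed.

Inductive grundy_value : game -> nat -> Prop :=
| Grundy_value (I : Type) (opt : I -> game) (v : I -> nat) (n : nat) of
    (forall i, grundy_value (opt i) (v i)) & is_mex v n :
    grundy_value (Game opt opt) n.

Lemma game_le_mexP {I J : Type} {x : I -> game} {y : J -> game}
    {v : I -> nat} {w : J -> nat} {m n : nat} :
  is_mex v m -> is_mex w n ->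
  (forall i, game_le (Game y y) (x i) <-> n = v i) ->
  (forall j, game_le (y j) (Game x x) <-> w j = m) ->
  game_le (Game x x) (Game y y) <-> m = n.
Proof.
move=> mex_v mex_w le_x le_y; rewrite game_leE (eq_mexP mex_v mex_w).
by split=> -[not_x not_y]; split=> [i /le_x /not_x|j /le_y /not_y].
Qed.

(* Passing to options exchanges the arguments of [game_le], so the induction
   needs both comparisons at once. *)
Lemma grundy_value_leP {x y : game} {m n : nat} :
  grundy_value x m -> grundy_value y n ->
  (game_le x y <-> m = n) /\ (game_le y x <-> n = m).
Proof.
move=> x_m; elim: x_m y n => {x m} I x v m _ IHx mex_v y n.
elim=> {y n} J y w n y_w IHy mex_w.
have y_n : grundy_value (Game y y) n := Grundy_value _ _ _ _ y_w mex_w.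
split.
- by apply: (game_le_mexP mex_v mex_w) => [i|j];
    [apply: (IHx i _ _ y_n).2 | apply: (IHy j).2].
- by apply: (game_le_mexP mex_w mex_v) => [j|i];
    [apply: (IHy j).1 | apply: (IHx i _ _ y_n).1].
Qed.

Lemma grundy_value_eq {x y : game} {n : nat} :
  grundy_value x n -> grundy_value y n -> game_eq x y.
Proof.
by move=> x_n y_n; have [le_xy le_yx] := grundy_value_leP x_n y_n;
  split; [apply/le_xy | apply/le_yx].
Qed.

Definition grundy_function {A : Type} (move : A -> A -> Prop) (g : A -> nat) :
    Prop :=
  forall a, is_mex (fun b : {b | move a b} => g (sval b)) (g a).

Lemma grundy_value_impartial_game {A : Type} {move : A -> A -> Prop}
    {g : A -> nat} (wf : terminating move) (a : A) :
  grundy_function move g -> grundy_value (impartial_game wf a) (g a).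
Proof.
rewrite /impartial_game => mex_g; elim/Acc_inv_dep: {a}(wf a) => a acc_a IHa.
by apply: Grundy_value (mex_g a) => -[b ab]; apply: IHa.
Qed.

Lemma grundy_function_nim : grundy_function nim_move id.
Proof.
move=> n; split=> [[k lt_kn] /= eq_kn|k lt_kn]; last by exists (exist _ k lt_kn).
by move: lt_kn; rewrite /nim_move eq_kn ltnn.
Qed.

Lemma impartial_game_eq_nimber {A : Type} {move : A -> A -> Prop} {g : A -> nat}
    (wf : terminating move) (a : A) :
  grundy_function move g -> game_eq (impartial_game wf a) (nimber (g a)).
Proof.
move=> mex_g; apply: (grundy_value_eq (n := g a)).
- exact: grundy_value_impartial_game.
- exact: grundy_value_impartial_game nim_terminating _ grundy_function_nim.
Qed.

Lemma pebble_move_lower {D : dag} {u v : D} {p : position D} {m : nat} :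
  arc u v -> m < p v -> exists2 q, pebble_move p q & q v = m.
Proof.
move=> uv lt_m; exists (transfer p v (p v - m) u (p v - m)).
- by apply: move_to_in_neighbour => //; lia.
- by rewrite ffunE eqxx; lia.
Qed.

Lemma pebble_move_neq {D : dag} {c : D} {p q : position D} :
  (forall u v, arc u v -> v = c) -> pebble_move p q -> q c <> p c.
Proof.
move=> arc_c [v u k /arc_c -> k_bounds|v w vw _].
- by rewrite ffunE eqxx; lia.
- have w_c := arc_c _ _ vw; have := arc_neq vw.
  by rewrite w_c eq_sym ffunE eqxx => /negPf ->; lia.
Qed.

Lemma grundy_function_sink {D : dag} {u c : D} :
  arc u c -> (forall v w, arc v w -> w = c) ->
  grundy_function (@pebble_move D) (fun p => p c).
Proof.
move=> uc arc_c p; split=> [[q pq]|m /(pebble_move_lower uc) [q pq qc]].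
- exact: pebble_move_neq pq.
- by exists (exist _ q pq).
Qed.

Theorem theorem6 (n : nat) (hn : 0 < n) (T : dag) (c : T) (leaf : 'I_n -> T)
    (hT : in_star c leaf) (p : position T) :
  game_eq (blocking_pebbles p) (nimber (p c)).
Proof.
have [_ _ arcP] := hT.
have leaf_c : arc (leaf (Ordinal hn)) c by apply/arcP; exists (Ordinal hn).
have arc_c u v : arc u v -> v = c by case/arcP=> i [].
exact: impartial_game_eq_nimber (grundy_function_sink leaf_c arc_c).
Qed.
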